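(* Let $q>p>1$, let $R>\frac{q^4}{p^4}>1$, $D_R=\{z\in\mathbb{C}:|z|<R\}$, and let $f:D_R\to\mathbb{C}$ be analytic in $D_R$, i.e. $f(z)=\sum_{k=0}^{\infty}c_kz^k$ for all $z\in D_R$. Let $r,r^{\ast},r_1$ be arbitrary fixed with $1\le r<r^{\ast}<\frac{p^3r_1}{q^3}<\frac{p^4R}{q^4}$, and let $m\in\mathbb{N}$. If $f$ is not a polynomial of degree $\le\max\{1,m-1\}$, then $$\left\|L_{n,p,q}^{(m)}(f)-f^{(m)}\right\|_r\sim\frac{p^n}{[n]_{p,q}}\quad\text{for all } n\in\mathbb{N},$$ that is, there exist constants $0<C_1\le C_2$, depending only on $f,r,r^{\ast},r_1,m,p,q$ and independent of $n$, such that $C_1\frac{p^n}{[n]_{p,q}}\le\left\|L_{n,p,q}^{(m)}(f)-f^{(m)}\right\|_r\le C_2\frac{p^n}{[n]_{p,q}}$ for all $n\in\mathbb{N}$. Here $L_{n,p,q}^{(m)}(f)$ and $f^{(m)}$ denote the ordinary $m$-th complex derivatives of $L_{n,p,q}(f)$ and $f$.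
   Context: $\mathbb{N}=\{1,2,3,\dots\}$ and $\|g\|_r=\max\{|g(z)|:|z|\le r\}$. For real $p\neq q$ positive, the $(p,q)$-integers are $[n]_{p,q}=\frac{p^n-q^n}{p-q}$, $n=0,1,2,\dots$; $[n]_{p,q}!=[1]_{p,q}[2]_{p,q}\cdots[n]_{p,q}$ with $[0]_{p,q}!=1$; and $\left[\begin{array}{c} n\\ k\end{array}\right]_{p,q}=\frac{[n]_{p,q}!}{[k]_{p,q}!\,[n-k]_{p,q}!}$. The $(p,q)$-derivative is $D_{p,q}f(x)=\frac{f(px)-f(qx)}{(p-q)x}$ for $x\neq0$ and $D_{p,q}f(0)=f'(0)$; in particular $D_{p,q}x^n=[n]_{p,q}x^{n-1}$. $D_{p,q}^{(k)}$ denotes the $k$-fold iterate of $D_{p,q}$ (for $f$ analytic near $0$, it is defined on a neighbourhood of $0$). For $f$ analytic in a disk centred at the origin, the $(p,q)$-Lorentz polynomials are $$L_{n,p,q}(f)(z)=L_{n,p,q}(f;z)=\sum_{k=0}^{n}q^{\frac{k(k-1)}{2}}\left[\begin{array}{c} n\\ k\end{array}\right]_{p,q}\left(\frac{z}{[n]_{p,q}}\right)^kD_{p,q}^{(k)}(f)(0),\quad n\in\mathbb{N},\ z\in\mathbb{C}.$$ *)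

(* Defs.v *)
From HB Require Import structures.
From mathcomp Require Import all_boot all_order all_algebra.
From mathcomp Require Import complex.
From mathcomp Require Import all_classical all_reals all_analysis.

Set Implicit Arguments.
Unset Strict Implicit.
Unset Printing Implicit Defensive.

Import Order.TTheory GRing.Theory Num.Theory numFieldNormedType.Exports.
Local Open Scope classical_set_scope.
Local Open Scope ring_scope.
Local Open Scope complex_scope.

(* The complex numbers are R[i] for R : realType; the alias (R[i])^o carries
   the normed module structure of R[i] over itself, so that derive1 and
   derive1n are the complex derivatives. The norm `|z| lives in R[i], whence
   the embeddings _%:C when it is compared with a real number. *)

Section pq_calculus.
Context {R : realType}.
Implicit Types p q : R.

Definition pqint p q n : R := (p ^+ n - q ^+ n) / (p - q).

Definition pqfact p q n : R := \prod_(1 <= i < n.+1) pqint p q i.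

Definition pqbin p q n k : R :=
  pqfact p q n / (pqfact p q k * pqfact p q (n - k)).

Definition pqderive p q (f : (R[i])^o -> (R[i])^o) : (R[i])^o -> (R[i])^o :=
  fun x => if x == 0 then derive1 f 0
           else (f (p%:C * x) - f (q%:C * x)) / ((p - q)%:C * x).

Definition pqderiven p q k (f : (R[i])^o -> (R[i])^o) : (R[i])^o -> (R[i])^o :=
  iter k (pqderive p q) f.

Definition pqlorentz p q n (f : (R[i])^o -> (R[i])^o) : (R[i])^o -> (R[i])^o :=
  fun z => \sum_(0 <= k < n.+1)
    (q ^+ (k * (k - 1) %/ 2) * pqbin p q n k)%:C *
    (z / (pqint p q n)%:C) ^+ k * pqderiven p q k f 0.

End pq_calculus.

Section disks.
Context {R : realType}.

Definition disk (rad : R) : set (R[i])^o := [set z | `|z| < rad%:C].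

(* Functions on a disk are total functions, only constrained on that disk. *)
Definition analytic_on_disk (rad : R) (f : (R[i])^o -> (R[i])^o) : Prop :=
  exists c : nat -> (R[i])^o, forall z, disk rad z ->
    series (fun k => c k * z ^+ k) @ \oo --> f z.

Definition poly_on_disk (rad : R) (d : nat) (f : (R[i])^o -> (R[i])^o) : Prop :=
  exists P : {poly R[i]},
    (size P <= d.+1)%N /\ forall z, disk rad z -> f z = P.[z].

(* The maximum of |g| over the closed disk of radius r, as an element of the
   set of values that bounds it from above; 0 if there is no maximum. *)
Definition maxnorm (r : R) (g : (R[i])^o -> (R[i])^o) : R :=
  let A := [set x : R | exists2 z, `|z| <= r%:C & `|g z| = x%:C] in
  xget 0 (A `&` ubound A).

End disks.

(* Main.v *)
Require Import Defs.
From HB Require Import structures.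
From mathcomp Require Import all_boot all_order all_algebra.
From mathcomp Require Import complex.
From mathcomp Require Import all_classical all_reals all_analysis.
From mathcomp Require Import ring lra.
Import Order.TTheory GRing.Theory Num.Theory numFieldNormedType.Exports.
Import ComplexField.Normc.
Local Open Scope classical_set_scope.
Local Open Scope ring_scope.
Local Open Scope complex_scope.

(** The polynomial [L_n f] multiplies the k-th Taylor coefficient [c_k] of [f]
    by a weight: since [D^(k) f (0) = [k]! c_k] and
    [[n] = q^j [n-j] + p^(n-j) [j]],
    [[
      L_n f (z) = sum_k a_(n,k) c_k z^k,
      a_(n,k) = prod_(j < k) q^j [n-j] / [n] = prod_(j < k) (1 - x_n w_j)
    ]]
    where [x_n = p^n / [n]] is the rate of the theorem and [w_j = [j] / p^j]
    does not depend on [n]. As [x_n w_j] increases to 1 when [j] goes from 0 to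
    [n], the first [n + 1] factors lie in [[0, 1]] and the last of them is 0, so
    the product also gives the truncation of the sum at [k = n]. Hence two
    bounds on the defect of the weights, both linear in [x_n]:
    - [1 - a_(n,k) <= x_n (w_0 + ... + w_(k-1)) <= A x_n (q/p)^k]
      ([lorentz_defect_le], [scaled_pqint_sum_le]);
    - [1 - a_(n,k) >= x_n w_1 = x_n / p] for [k >= 2] ([lorentz_defect_ge]).

    The m-th derivative of [L_n f - f] is a power series, obtained by
    differentiating term by term. The first bound dominates it on the disk of
    radius [r] by [x_n] times a series independent of [n], which converges
    because [r q / p < rad] ([error_upper]). For the lower bound let [k] be the
    least index with [k >= 2], [k >= m] and [c_k <> 0]; it exists as [f] is not a
    polynomial of degree at most [max 1 (m-1)]. The coefficients of index below
    [k - m] of the differentiated series vanish, because [c_j = 0] for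
    [2 <= j < k] with [j >= m], and the weights of index 0 and 1 are equal to 1. The
    coefficient of index [k - m] is at least a constant times
    [x_n] by the second bound. At a point [s > 0] close enough to 0, chosen
    independently of [n], this term outweighs the rest of the series
    ([error_lower]). Both estimates hold for every [n >= 1] at once.

    The analytic ingredients are elementary: absolutely convergent complex
    series converge ([cvg_abs_series]), power series have a uniform first-order
    Taylor expansion ([power_sum_taylor]), and a continuous function attains its
    maximum modulus on a closed disk ([maxnorm_attained]). *)

(** * Modulus and convergence in the complex numbers *)

Section complex_modulus.
Context {R : realType}.
Implicit Types (z w : R[i]) (x : R).

Lemma normr_normc z : `|z| = (normc z)%:C.
Proof. by case: z. Qed.

Lemma normc_ge0 z : 0 <= normc z.
Proof. by case: z => a b; rewrite /= sqrtr_ge0. Qed.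

Lemma normc_triangle z w : normc (z + w) <= normc z + normc w.
Proof. by rewrite -lecR rmorphD -!normr_normc; exact: ler_normD. Qed.

Lemma normc_opp z : normc (- z) = normc z.
Proof. by apply: complexI; rewrite -!normr_normc normrN. Qed.

Lemma normc_distC z w : normc (z - w) = normc (w - z).
Proof. by rewrite -normc_opp opprB. Qed.

Lemma normc_pow z n : normc (z ^+ n) = normc z ^+ n.
Proof. by elim: n => [|n IH]; rewrite ?normc1// !exprS normcM IH. Qed.

Lemma normc_real x : 0 <= x -> normc x%:C = x.
Proof. by move=> x0; rewrite /= expr0n/= addr0 sqrtr_sqr ger0_norm. Qed.

Lemma normc_nat n : normc (n%:R : R[i]) = n%:R.
Proof. by rewrite -(rmorph_nat (real_complex R)) normc_real. Qed.

Lemma normc_gt0 z : (0 < normc z) = (z != 0).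
Proof.
rewrite lt_def normc_ge0 andbT; apply/idP/idP; apply: contra_neq.
  by move=> ->; rewrite normc0.
exact: eq0_normc.
Qed.

Lemma normc_sum (u : nat -> R[i]) n :
  normc (\sum_(0 <= k < n) u k) <= \sum_(0 <= k < n) normc (u k).
Proof.
elim: n => [|n IH]; first by rewrite !big_geq// normc0.
rewrite !big_nat_recr//=; apply: le_trans (normc_triangle _ _) _.
by rewrite lerD2r.
Qed.

Lemma normr_Re_le z : `|complex.Re z| <= normc z.
Proof.
by case: z => a b /=; rewrite -sqrtr_sqr ler_sqrt ?lerDl ?addr_ge0 ?sqr_ge0.
Qed.

Lemma normr_Im_le z : `|complex.Im z| <= normc z.
Proof.
by case: z => a b /=; rewrite -sqrtr_sqr ler_sqrt ?lerDr ?addr_ge0 ?sqr_ge0.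
Qed.

Lemma normc_le_ReIm z : normc z <= `|complex.Re z| + `|complex.Im z|.
Proof.
case: z => a b /=; rewrite -[leRHS]ger0_norm ?addr_ge0// -sqrtr_sqr ler_sqrt.
  rewrite sqrrD !real_normK ?num_real// lerD2r lerDl.
  by rewrite mulrn_wge0 ?mulr_ge0.
by rewrite sqr_ge0.
Qed.

(** Neighbourhoods in [R[i]] are indexed by positive elements of [R[i]], which
    are exactly the embedded positive reals; this allows real epsilons. *)
Lemma cvgC_normcP {T} {F : set_system T} {FF : Filter F}
    (f : T -> (R[i])^o) (l : (R[i])^o) :
  f @ F --> l <->
  forall e : R, 0 < e -> \forall x \near F, normc (l - f x) < e.
Proof.
split=> [/cvgrPdist_lt fl e e0|fl].
  have e0' : (0 : R[i]) < e%:C by rewrite ltcR.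
  by move: (fl _ e0'); apply: filterS => x; rewrite normr_normc ltcR.
apply/cvgrPdist_lt => e e0.
have eE : e = (complex.Re e)%:C by rewrite RRe_real// gtr0_real.
rewrite eE; move: e0; rewrite eE ltcR => /fl.
by apply: filterS => x; rewrite normr_normc ltcR.
Qed.

Lemma cvgC_unique {T} {F : set_system T} {FF : ProperFilter F}
    (f : T -> (R[i])^o) (l : (R[i])^o) : f @ F --> l -> lim (f @ F) = l.
Proof. by move=> /cvg_lim; apply; exact: norm_hausdorff. Qed.

Lemma normc_lim_le (u : nat -> (R[i])^o) (l : (R[i])^o) M n0 :
  u @ \oo --> l -> (forall n, (n0 <= n)%N -> normc (u n) <= M) ->
  normc l <= M.
Proof.
move=> /cvgC_normcP ul uM; apply/ler_addgt0Pr => e e0.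
have [N _ Nl] := ul _ e0.
have /= lN := Nl (maxn n0 N) (leq_maxr _ _).
rewrite -(subrK (u (maxn n0 N)) l) addrC.
by apply: le_trans (normc_triangle _ _) _; rewrite lerD ?uM ?leq_maxl// ltW.
Qed.

(** Absolute convergence implies convergence: the real and imaginary parts
    converge absolutely, and the field of reals is complete. *)
Lemma cvg_abs_series (u : nat -> (R[i])^o) V :
  (forall n, \sum_(0 <= k < n) normc (u k) <= V) ->
  series u @ \oo --> limn (series u).
Proof.
move=> uV.
have part (g : R[i] -> R) : g 0 = 0 -> {morph g : z w / z + w} ->
    (forall z, `|g z| <= normc z) ->
    exists l : R, (fun n => g (series u n)) @ \oo --> l.
  move=> g0 gD gle; exists (limn (series (g \o u))).
  have -> : (fun n => g (series u n)) = series (g \o u).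
    by apply/funext => n; rewrite /series/=; exact: big_morph.
  apply: normed_cvg; apply: nondecreasing_is_cvgn.
    by apply: nondecreasing_series => k _ _ /=.
  exists V => _ [n _ <-]; apply: le_trans (uV n).
  by rewrite /series/=; apply: ler_sum => k _; exact: gle.
have [a /cvgrPdist_lt ua] := part _ erefl (@raddfD _ _ (@complex.Re R))
  normr_Re_le.
have [b /cvgrPdist_lt ub] := part _ erefl (@raddfD _ _ (@complex.Im R))
  normr_Im_le.
suff ul : series u @ \oo --> ((a +i* b) : (R[i])^o).
  by rewrite (cvgC_unique _ _ ul).
apply/cvgC_normcP => e e0.
have e20 : 0 < e / 2 by rewrite divr_gt0.
move: (ua _ e20) (ub _ e20); apply: filterS2 => n an bn.
apply: le_lt_trans (normc_le_ReIm _) _; rewrite !raddfB/= [e]splitr.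
exact: ltrD.
Qed.

Lemma normc_lim_series_le (u : nat -> (R[i])^o) V :
  (forall n, \sum_(0 <= k < n) normc (u k) <= V) -> normc (limn (series u)) <= V.
Proof.
move=> uV; apply: (@normc_lim_le _ _ _ 0%N (cvg_abs_series _ _ uV)) => n _.
exact: le_trans (normc_sum _ _) (uV n).
Qed.

Lemma lim_series_finite (u : nat -> (R[i])^o) N :
  (forall k, (N <= k)%N -> u k = 0) ->
  series u @ \oo --> (\sum_(0 <= k < N) u k : (R[i])^o).
Proof.
move=> u0; apply/cvgC_normcP => e e0; exists N => // n /= Nn.
suff -> : series u n = \sum_(0 <= k < N) u k by rewrite subrr normc0.
rewrite /series/= (@big_cat_nat _ _ _ N 0 n)//= [X in _ + X = _]big_nat_cond.
by rewrite [X in _ + X]big1 ?addr0// => k /andP[/andP[Nk _] _]; exact: u0.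
Qed.
End complex_modulus.

(** * Power series and their termwise derivatives *)

#[local] Arguments normc {R} x : simpl never.

Section power_series.
Context {R : realType}.
Implicit Types (b c : nat -> R[i]) (z h : R[i]) (s rho : R).

(** The radius of convergence is at least [rho]. Boundedness of the terms on
    every smaller circle is the form that is stable under all the operations on
    coefficients below, and it already yields absolute convergence. *)
Definition has_radius rho b : Prop :=
  forall s, 0 <= s -> s < rho -> exists M, forall k, normc (b k) * s ^+ k <= M.

Definition power_sum b : (R[i])^o -> (R[i])^o :=
  fun z => limn (series (fun k => b k * z ^+ k : (R[i])^o)).

Definition coef_deriv b : nat -> R[i] := fun k => k.+1%:R * b k.+1.

Lemma has_radius_summable rho b s : has_radius rho b -> 0 <= s -> s < rho ->
  exists V, forall n, \sum_(0 <= k < n) normc (b k) * s ^+ k <= V.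
Proof.
move=> hb s0 srho; set s' := (s + rho) / 2.
have ss' : s < s' by rewrite /s'; lra.
have s'0 : 0 < s' by rewrite (le_lt_trans s0).
have [|M hM] := hb s' (ltW s'0); first by rewrite /s'; lra.
have M0 : 0 <= M.
  by apply: le_trans (hM 0%N); rewrite expr0 mulr1 normc_ge0.
set x := s / s'.
have x0 : 0 <= x by rewrite divr_ge0// ltW.
have x1 : x < 1 by rewrite ltr_pdivrMr// mul1r.
have x1' : 0 < 1 - x by rewrite subr_gt0.
exists (M / (1 - x)) => n; apply: (@le_trans _ _ (M * (1 - x ^+ n) / (1 - x))).
  elim: n => [|n IH]; first by rewrite big_geq// expr0 subrr mulr0 mul0r.
  rewrite big_nat_recr//=; apply: (le_trans (lerD IH (_ : _ <= M * x ^+ n))).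
    rewrite (_ : s ^+ n = s' ^+ n * x ^+ n); last first.
      by rewrite -exprMn /x mulrC divfK// gt_eqF.
    by rewrite mulrA ler_wpM2r// exprn_ge0.
  rewrite exprS le_eqVlt; apply/orP; left; apply/eqP.
  by field; rewrite gt_eqF.
rewrite ler_pM2r ?invr_gt0//.
by rewrite ler_piMr// lerBlDr lerDl exprn_ge0.
Qed.

(** Weights of geometric growth [t ^ k] shrink the disk by the factor [t]. *)
Lemma has_radius_weight rho b (w : nat -> R[i]) A t : 0 < t ->
  (forall k, normc (w k) <= A * t ^+ k) -> has_radius rho b ->
  has_radius (rho / t) (fun k => w k * b k).
Proof.
move=> t0 wA hb s s0; rewrite ltr_pdivlMr// => strho.
have [M hM] := hb (s * t) (mulr_ge0 s0 (ltW t0)) strho.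
have A0 : 0 <= A.
  by have := wA 0%N; rewrite expr0 mulr1; apply: le_trans; rewrite normc_ge0.
exists (A * M) => k; apply: le_trans (ler_wpM2l A0 (hM k)).
rewrite normcM exprMn.
have -> : A * (normc (b k) * (s ^+ k * t ^+ k)) =
  A * t ^+ k * (normc (b k) * s ^+ k) by ring.
by rewrite -mulrA ler_wpM2r// mulr_ge0 ?normc_ge0 ?exprn_ge0.
Qed.

Lemma has_radius_shift rho b :
  has_radius rho b -> has_radius rho (fun k => b k.+1).
Proof.
move=> hb s s0 srho; set s' := (s + rho) / 2.
have ss' : s < s' by rewrite /s'; lra.
have s'0 : 0 < s' by rewrite (le_lt_trans s0).
have [|M hM] := hb s' (ltW s'0); first by rewrite /s'; lra.
exists (M / s') => k; rewrite ler_pdivlMr//; apply: le_trans (hM k.+1).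
rewrite -mulrA exprSr ler_wpM2l ?normc_ge0// ler_wpM2r ?(ltW s'0)//.
by rewrite lerXn2r ?nnegrE ?(ltW s'0)// ltW.
Qed.

(** The derivative of [x ^ (k + 1)] at [s] is at most the slope of its chord
    from [s] to [s']. *)
Lemma natmul_expr_le s s' k : 0 <= s -> s <= s' ->
  k.+1%:R * s ^+ k * (s' - s) <= s' ^+ k.+1 - s ^+ k.+1.
Proof.
move=> s0 ss'; have s'0 := le_trans s0 ss'.
elim: k => [|k IH]; first by rewrite expr0 !expr1 !mul1r.
have h1 : s * (k.+1%:R * s ^+ k * (s' - s)) <= s * (s' ^+ k.+1 - s ^+ k.+1).
  exact: ler_wpM2l.
have h2 : s ^+ k.+1 * (s' - s) <= s' ^+ k.+1 * (s' - s).
  by rewrite ler_wpM2r ?subr_ge0// lerXn2r ?nnegrE.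
rewrite -[k.+2%:R]natr1; move: h1 h2; rewrite !exprS.
set a := s ^+ k; set a' := s' ^+ k; set n := k.+1%:R.
lra.
Qed.

(** A polynomial factor is absorbed by an arbitrarily small increase of the
    radius, so it does not affect the open disk of convergence. *)
Lemma has_radius_natmul rho b :
  has_radius rho b -> has_radius rho (fun k => k%:R * b k).
Proof.
move=> hb s s0 srho; set s' := (s + rho) / 2.
have ss' : s < s' by rewrite /s'; lra.
have s'0 : 0 < s' by rewrite (le_lt_trans s0).
have d0 : 0 < s' - s by rewrite subr_gt0.
have [|M hM] := hb s' (ltW s'0); first by rewrite /s'; lra.
exists (s' * M / (s' - s)) => k; rewrite normcM normc_nat ler_pdivlMr//.
apply: le_trans (ler_wpM2l (ltW s'0) (hM k)).
have -> : k%:R * normc (b k) * s ^+ k * (s' - s) =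
  normc (b k) * (k%:R * s ^+ k * (s' - s)) by ring.
have -> : s' * (normc (b k) * s' ^+ k) = normc (b k) * s' ^+ k.+1.
  by rewrite exprS; ring.
apply: ler_wpM2l; first exact: normc_ge0.
have := natmul_expr_le _ _ k s0 (ltW ss'); have := exprn_ge0 k.+1 s0.
have : 0 <= s ^+ k * (s' - s) by rewrite mulr_ge0 ?exprn_ge0// ltW.
by rewrite -[k.+1%:R]natr1; lra.
Qed.

Lemma has_radius_coef_deriv rho b :
  has_radius rho b -> has_radius rho (coef_deriv b).
Proof. by move=> /has_radius_natmul/has_radius_shift. Qed.

Lemma has_radius_iter_coef_deriv rho b m :
  has_radius rho b -> has_radius rho (iter m coef_deriv b).
Proof. by move=> hb; elim: m => //= m; exact: has_radius_coef_deriv. Qed.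

Lemma power_sum_cvg rho b z : has_radius rho b -> normc z < rho ->
  series (fun k => b k * z ^+ k : (R[i])^o) @ \oo --> power_sum b z.
Proof.
move=> hb zrho; have [V hV] := has_radius_summable _ _ _ hb (normc_ge0 z) zrho.
apply: (cvg_abs_series _ V) => n; apply: le_trans (hV n).
by apply: ler_sum => k _; rewrite normcM normc_pow.
Qed.

Lemma power_sum_finite b z N : (forall k, (N <= k)%N -> b k = 0) ->
  power_sum b z = \sum_(0 <= k < N) b k * z ^+ k.
Proof.
move=> b0; apply: cvgC_unique; apply: lim_series_finite => k /b0 ->.
by rewrite mul0r.
Qed.

Lemma power_sum0 b : power_sum b 0 = b 0%N.
Proof.
apply: cvgC_unique.
have -> : b 0%N = \sum_(0 <= k < 1) b k * 0 ^+ k by rewrite big_nat1 expr0 mulr1.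
by apply: lim_series_finite => -[|k] // _; rewrite expr0n mulr0.
Qed.

Lemma eq_power_sum b c z : (forall k, b k = c k) -> power_sum b z = power_sum c z.
Proof. by move=> /funext ->. Qed.

Lemma power_sum_lincomb rho b c z u : has_radius rho b -> has_radius rho c ->
  normc z < rho ->
  power_sum b z - u * power_sum c z = power_sum (fun k => b k - u * c k) z.
Proof.
move=> hb hc zrho; apply/esym/cvgC_unique.
rewrite (_ : series _ = (fun n =>
    series (fun k => b k * z ^+ k : (R[i])^o) n -
    u *: series (fun k => c k * z ^+ k : (R[i])^o) n)).
  by apply: cvgB; [|apply: cvgZl_tmp]; exact: power_sum_cvg zrho.
apply/funext => n; rewrite /series/= [X in _ - X]mulr_sumr -sumrB.
by apply: eq_bigr => k _; rewrite mulrBl mulrA.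
Qed.

(** The second-order remainder of [(z + h) ^+ k], divided by [h ^+ 2]. *)
Fixpoint taylor_rem z h k : R[i] :=
  if k is k'.+1 then (h + z) * taylor_rem z h k' + k'%:R * z ^+ k'.-1 else 0.

Lemma taylor_remE z h k :
  (h + z) ^+ k = z ^+ k + h * (k%:R * z ^+ k.-1) + h ^+ 2 * taylor_rem z h k.
Proof.
elim: k => [|k IH]; first by rewrite !expr0 mul0r !mulr0 !addr0.
rewrite exprS {}IH -natr1 [RHS]/=; set t := taylor_rem _ _ _; move: t.
case: k => [|k] t; first by rewrite /= !expr0; ring.
by rewrite -pred_Sn !exprS; ring.
Qed.

Lemma normc_taylor_rem_le z h k s : 0 < s -> normc z <= s ->
  normc (h + z) <= s ->
  s ^+ 2 * normc (taylor_rem z h k) <= k%:R * (k%:R * s ^+ k).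
Proof.
move=> s0 zs hs; have s0' := ltW s0.
elim: k => [|k IH]; first by rewrite /= normc0 mulr0 mul0r.
have h1 : s ^+ 2 * normc ((h + z) * taylor_rem z h k) <=
          s * (k%:R * (k%:R * s ^+ k)).
  rewrite normcM mulrCA; apply: ler_pM => //; first exact: normc_ge0.
  by rewrite mulr_ge0 ?exprn_ge0 ?normc_ge0.
have h2 : s ^+ 2 * normc (k%:R * z ^+ k.-1) <= k%:R * s ^+ k.+1.
  rewrite normcM normc_nat normc_pow mulrCA; case: {IH h1} k => [|k].
    by rewrite !mul0r.
  rewrite ler_wpM2l// -[k.+2]add2n exprD ler_wpM2l ?exprn_ge0//=.
  by rewrite lerXn2r ?nnegrE ?normc_ge0.
apply: (@le_trans _ _ (s ^+ 2 * (normc ((h + z) * taylor_rem z h k) +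
    normc (k%:R * z ^+ k.-1)))).
  by rewrite ler_wpM2l ?exprn_ge0//; exact: normc_triangle.
rewrite mulrDr; apply: le_trans (lerD h1 h2) _.
rewrite exprS -natr1.
have := mulr_ge0 s0' (exprn_ge0 k s0'); have : 0 <= k%:R :> R by [].
set x := k%:R; set y := s ^+ k; nra.
Qed.

Lemma power_sum_derivE rho b z : has_radius rho b -> normc z < rho ->
  series (fun k => b k * (k%:R * z ^+ k.-1) : (R[i])^o) @ \oo -->
  power_sum (coef_deriv b) z.
Proof.
move=> hb zrho; rewrite -cvg_shiftS.
(* The term of index 0 vanishes, so the partial sums are shifted by one. *)
rewrite (_ : [sequence _]_n =
    series (fun k => coef_deriv b k * z ^+ k : (R[i])^o)).
  exact: power_sum_cvg (has_radius_coef_deriv _ _ hb) zrho.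
apply/funext => n; rewrite /series/= big_nat_recl//= mul0r mulr0 add0r.
by apply: eq_bigr => k _; rewrite /coef_deriv; ring.
Qed.

(** First-order Taylor expansion, uniformly on a smaller closed disk: the
    remainder of each monomial is dominated by [k ^ 2 * s ^ k], which a power
    series tolerates. Differentiability and continuity both follow from it. *)
Lemma power_sum_taylor rho b s : has_radius rho b -> 0 < s -> s < rho ->
  exists K, 0 <= K /\ forall z h, normc z <= s -> normc (h + z) <= s ->
  normc (power_sum b (h + z) - power_sum b z - h * power_sum (coef_deriv b) z)
    <= normc h ^+ 2 * K.
Proof.
move=> hb s0 srho.
have [V hV] := has_radius_summable _ _ _
  (has_radius_natmul _ _ (has_radius_natmul _ _ hb)) (ltW s0) srho.
have V0 : 0 <= V by have := hV 0%N; rewrite big_geq.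
exists (V / s ^+ 2); split; first by rewrite divr_ge0// exprn_ge0// ltW.
move=> z h zs hs.
have ul := cvgB (cvgB
  (power_sum_cvg _ _ _ hb (le_lt_trans hs srho))
  (power_sum_cvg _ _ _ hb (le_lt_trans zs srho)))
  (cvgZl_tmp (k := h) (power_sum_derivE _ _ _ hb (le_lt_trans zs srho))).
have := @normc_lim_le _ _ _ (normc h ^+ 2 * (V / s ^+ 2)) 0%N (ul _ _ _).
apply => n _.
rewrite [X in normc X](_ : _ =
    h ^+ 2 * \sum_(0 <= k < n) b k * taylor_rem z h k); last first.
  rewrite /series !fctE -sumrB [X in _ - X]mulr_sumr -sumrB mulr_sumr.
  by apply: eq_bigr => k _; rewrite taylor_remE; ring.
rewrite normcM normc_pow; apply: ler_wpM2l.
  by rewrite exprn_ge0 ?normc_ge0.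
apply: le_trans (normc_sum _ _) _; rewrite ler_pdivlMr ?exprn_gt0// mulr_suml.
apply: le_trans (hV n); apply: ler_sum => k _.
rewrite !normcM !normc_nat.
have := ler_wpM2l (normc_ge0 (b k)) (normc_taylor_rem_le _ _ k _ s0 zs hs).
by congr (_ <= _); ring.
Qed.

Lemma derive1_power_sum rho b f : has_radius rho b ->
  (forall z, normc z < rho -> f z = power_sum b z) ->
  forall z, normc z < rho -> derive1 f z = power_sum (coef_deriv b) z.
Proof.
move=> hb fb z zrho; set s := (normc z + rho) / 2.
have zs : normc z < s by rewrite /s; lra.
have srho : s < rho by rewrite /s; lra.
have s0 : 0 < s by apply: le_lt_trans zs; exact: normc_ge0.
have [K [K0 hK]] := power_sum_taylor _ _ _ hb s0 srho.
apply: cvgC_unique; apply/cvgC_normcP => e e0.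
set d := Num.min (s - normc z) (e / (K + 1)).
have d0 : 0 < d by rewrite lt_min subr_gt0 zs divr_gt0// ltr_wpDl.
have d0' : (0 : R[i]) < d%:C by rewrite ltcR.
near=> h.
have : `|h : (R[i])^o| < d%:C by near: h; exact: dnbhs0_lt.
have h0 : h != 0 by near: h; exact: nbhs_dnbhs_neq.
rewrite normr_normc ltcR lt_min => /andP[hd1 hd2].
have hzs : normc (h + z) <= s.
  by apply: le_trans (normc_triangle _ _) _; lra.
have nh0 : 0 < normc h by rewrite normc_gt0.
rewrite (fb _ zrho) (fb (h + z) (le_lt_trans hzs srho)) normc_distC.
have -> : h^-1 *: (power_sum b (h + z) - power_sum b z) -
    power_sum (coef_deriv b) z = h^-1 * (power_sum b (h + z) - power_sum b z -
    h * power_sum (coef_deriv b) z) by rewrite [RHS]mulrBr mulKf.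
rewrite normcM normcV mulrC ltr_pdivrMr//.
apply: le_lt_trans (hK _ _ (ltW zs) hzs) _.
rewrite expr2 -mulrA mulrC ltr_pM2r//.
move: hd2; rewrite ltr_pdivlMr ?ltr_wpDl//; lra.
Unshelve. all: by end_near. Qed.

Lemma derive1n_power_sum rho b f m : has_radius rho b ->
  (forall z, normc z < rho -> f z = power_sum b z) ->
  forall z, normc z < rho ->
  derive1n m f z = power_sum (iter m coef_deriv b) z.
Proof.
move=> hb fb; elim: m => [|m IH]; first exact: fb.
move=> z zrho; rewrite derive1nS iterS.
by apply: derive1_power_sum zrho => //; exact: has_radius_iter_coef_deriv.
Qed.

Lemma power_sum_continuous rho b (z : (R[i])^o) : has_radius rho b ->
  normc z < rho -> {for z, continuous (power_sum b)}.
Proof.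
move=> hb zrho; set s := (normc z + rho) / 2.
have zs : normc z < s by rewrite /s; lra.
have srho : s < rho by rewrite /s; lra.
have s0 : 0 < s by apply: le_lt_trans zs; exact: normc_ge0.
have [K [K0 hK]] := power_sum_taylor _ _ _ hb s0 srho.
set D := normc (power_sum (coef_deriv b) z).
have D0 : 0 <= D := normc_ge0 _.
apply/(@cvgC_normcP _ _ (nbhs (z : (R[i])^o)) _) => e e0.
have DsK : 0 < D + s * K + s * K + 1.
  by rewrite ltr_wpDl// !addr_ge0// mulr_ge0// ltW.
set d := Num.min (s - normc z) (e / (D + s * K + s * K + 1)).
have d0 : 0 < d by rewrite lt_min subr_gt0 zs divr_gt0.
have d0' : (0 : R[i]) < d%:C by rewrite ltcR.
near=> y; set h := y - z.
have : `|z - y : (R[i])^o| < d%:C by near: y; exact: cvgr_dist_lt.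
rewrite normr_normc normc_distC -/h ltcR lt_min => /andP[hd1 hd2].
have yE : y = h + z by rewrite subrK.
have hzs : normc (h + z) <= s.
  by apply: le_trans (normc_triangle _ _) _; lra.
have := hK _ _ (ltW zs) hzs; rewrite -yE => hKy.
rewrite normc_distC.
rewrite -[_ - _](subrK (h * power_sum (coef_deriv b) z)).
apply: le_lt_trans (normc_triangle _ _) _; rewrite normcM -/D.
apply: le_lt_trans (lerD hKy (lexx _)) _.
move: hd2; rewrite ltr_pdivlMr//; apply: le_lt_trans.
have nh0 := normc_ge0 h; have := normc_ge0 z => z0.
have : 0 <= normc h * K * (2 * s - normc h).
  by rewrite mulr_ge0 ?mulr_ge0//; lra.
by rewrite expr2; lra.
Unshelve. all: by end_near. Qed.

End power_series.

(** * The maximum modulus on a closed disk *)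

Section maximum_modulus.
Context {R : realType}.
Implicit Types (r : R) (g : (R[i])^o -> (R[i])^o) (z : R[i]).

Definition complex_of_pair (x : R * R) : (R[i])^o := x.1 +i* x.2.

Lemma complex_of_pair_continuous : continuous complex_of_pair.
Proof.
move=> x; apply/(@cvgC_normcP _ _ (nbhs x) _) => e e0.
have e20 : 0 < e / 2 by rewrite divr_gt0.
near=> y.
apply: le_lt_trans (normc_le_ReIm _) _; rewrite [e]splitr /=; apply: ltrD.
- by near: y; apply: cvgr_dist_lt => //; exact: cvg_fst.
- by near: y; apply: cvgr_dist_lt => //; exact: cvg_snd.
Unshelve. all: by end_near. Qed.

Lemma normc_comp_continuous T (F : T -> (R[i])^o) (S : set_system T)
    (FS : Filter S) (l : (R[i])^o) :
  F @ S --> l -> (fun x => normc (F x)) @ S --> normc l.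
Proof.
move=> /cvgC_normcP Fl; apply/cvgrPdist_lt => e /Fl; apply: filterS => x.
apply: le_lt_trans; rewrite ler_norml.
have := normc_triangle (l - F x) (F x); rewrite subrK.
have := normc_triangle (F x - l) l; rewrite subrK [normc (F x - l)]normc_distC.
by move=> *; apply/andP; split; lra.
Qed.

(** The closed disk as a subset of the real plane, where it is a closed part of
    a compact square. *)
Definition closed_disk r : set (R * R) := [set x | normc (complex_of_pair x) <= r].

Lemma closed_disk_compact r : compact (closed_disk r).
Proof.
apply: (@subclosed_compact _ _ (`[- r, r] `*` `[- r, r])).
- apply: (@preimage_closed _ _ _ [set x : R | x <= r]); last exact: closed_le.
  move=> x _; apply: normc_comp_continuous; exact: complex_of_pair_continuous.
- by apply: compact_setX; exact: segment_compact.
- move=> [a b] /= ab; rewrite !in_itv/= -!ler_norml; split.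
    exact: le_trans (normr_Re_le (a +i* b)) ab.
  exact: le_trans (normr_Im_le (a +i* b)) ab.
Qed.

Lemma maxnorm_attained r g : 0 <= r ->
  (forall z, normc z <= r -> {for z, continuous g}) ->
  (exists2 z, normc z <= r & maxnorm r g = normc (g z)) /\
  (forall z, normc z <= r -> normc (g z) <= maxnorm r g).
Proof.
move=> r0 gc.
have [||x] := @compact_EVT_max _ _ (fun x => normc (g (complex_of_pair x))) _ _
  (closed_disk_compact r).
- by exists (0, 0); rewrite /closed_disk/= normc0.
- apply: continuous_in_subspaceT => x; rewrite inE => xr.
  apply: normc_comp_continuous.
  apply: continuous_comp; first exact: complex_of_pair_continuous.
  exact: gc.
rewrite inE => xr xmax.
set m := normc (g (complex_of_pair x)).
have ub z : normc z <= r -> normc (g z) <= m.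
  by move=> zr; case: z zr => a b abr; apply: (xmax (a, b)); rewrite inE.
suff -> : maxnorm r g = m by split=> //; exists (complex_of_pair x).
rewrite /maxnorm; case: xgetP => [y -> [[z zr gz] yub]|/(_ m) []].
  rewrite lecR in zr; case: gz => gz.
  apply/eqP; rewrite eq_le; apply/andP; split; first by rewrite -gz; exact: ub.
  by apply: yub; exists (complex_of_pair x); rewrite ?lecR.
split; first by exists (complex_of_pair x); rewrite ?lecR.
by move=> y [z]; rewrite lecR => zr [<-]; exact: ub.
Qed.

End maximum_modulus.

(** * Coefficientwise operations and estimates *)

Section power_series_complements.
Context {R : realType}.
Implicit Types (b c d : nat -> R[i]) (z u : R[i]) (s rho : R).

Lemma iter_coef_derivE m b k :
  iter m coef_deriv b k = ((k + m) ^_ m)%:R * b (k + m)%N.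
Proof.
elim: m k => [|m IH] k; first by rewrite addn0 ffactn0 mul1r.
rewrite iterS /coef_deriv IH addnS -addSn ffactnSr addnK natrM.
by rewrite mulrA [k.+1%:R * _]mulrC.
Qed.

Lemma iter_coef_deriv_weight m (w : nat -> R[i]) b k :
  iter m coef_deriv (fun k => w k * b k) k =
  w (k + m)%N * iter m coef_deriv b k.
Proof. by rewrite !iter_coef_derivE mulrCA. Qed.

Lemma power_sum_scale b u z :
  power_sum b (u * z) = power_sum (fun k => u ^+ k * b k) z.
Proof.
rewrite /power_sum; congr (limn (series _)); apply/funext => k.
by rewrite exprMn; ring.
Qed.

(** Division of a series without constant term by [u * z], in the form needed
    for difference quotients. *)
Lemma power_sum_factor rho b c u z : has_radius rho c -> normc z < rho ->
  b 0%N = 0 -> (forall k, b k.+1 = u * c k) ->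
  power_sum b z = u * z * power_sum c z.
Proof.
move=> hc zrho b0 bS; apply: cvgC_unique; rewrite -cvg_shiftS.
rewrite (_ : [sequence _]_n = fun n =>
    (u * z) *: series (fun k => c k * z ^+ k : (R[i])^o) n).
  by apply: cvgZl_tmp; exact: power_sum_cvg zrho.
apply/funext => n; rewrite /series/= big_nat_recl//= b0 mul0r add0r.
by rewrite [RHS]mulr_sumr; apply: eq_bigr => k _; rewrite bS exprS; ring.
Qed.

Lemma normc_power_sum_le b z r V : normc z <= r ->
  (forall n, \sum_(0 <= k < n) normc (b k) * r ^+ k <= V) ->
  normc (power_sum b z) <= V.
Proof.
move=> zr hV; apply: normc_lim_series_le => n; apply: le_trans (hV n).
apply: ler_sum => k _; rewrite normcM normc_pow ler_wpM2l ?normc_ge0//.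
by rewrite lerXn2r ?nnegrE ?normc_ge0// (le_trans _ zr) ?normc_ge0.
Qed.

(** Close to the origin a power series is governed by its first nonzero
    coefficient; on the unit disk all further terms gain a factor [s]. *)
Lemma normc_power_sum_ge b (B : nat -> R) j0 s V : 0 <= s -> s <= 1 ->
  (forall j, (j < j0)%N -> b j = 0) -> (forall k, normc (b k) <= B k) ->
  (forall n, \sum_(0 <= k < n) B k <= V) ->
  s ^+ j0 * (normc (b j0) - s * V) <= normc (power_sum b s%:C).
Proof.
move=> s0 s1 b0 bB BV.
have B0 k : 0 <= B k := le_trans (normc_ge0 _) (bB k).
have bs k : normc (b k * s%:C ^+ k) = normc (b k) * s ^+ k.
  by rewrite normcM normc_pow normc_real.
have uV : forall n, \sum_(0 <= k < n) normc (b k * s%:C ^+ k) <= V.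
  move=> n; apply: le_trans (BV n); apply: ler_sum => k _; rewrite bs.
  by rewrite -[leRHS]mulr1 ler_pM ?normc_ge0 ?exprn_ge0 ?exprn_ile1.
have ul := cvgB (cvg_abs_series _ _ uV)
  (cvg_cst (b j0 * s%:C ^+ j0 : (R[i])^o)).
have := @normc_lim_le _ _ _ (s ^+ j0 * (s * V)) j0.+1 (ul _ _).
rewrite -/(power_sum b s%:C) => /(_ _) tail.
suff /tail : forall n, (j0 < n)%N ->
    normc (series (fun k => b k * s%:C ^+ k : (R[i])^o) n -
           b j0 * s%:C ^+ j0) <= s ^+ j0 * (s * V).
  have := normc_triangle (b j0 * s%:C ^+ j0 - power_sum b s%:C)
    (power_sum b s%:C).
  by rewrite subrK bs [normc (_ - _)]normc_distC mulrBr; lra.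
move=> n j0n; rewrite /series/=.
rewrite (_ : _ - _ = \sum_(0 <= k < n)
    (b k * s%:C ^+ k - if k == j0 then b j0 * s%:C ^+ j0 else 0)); last first.
  by rewrite sumrB -big_mkcond/= big_nat1_eq j0n.
apply: le_trans (normc_sum _ _) _.
apply: (@le_trans _ _ (s ^+ j0 * s * \sum_(0 <= k < n) B k)); last first.
  by rewrite -mulrA ler_wpM2l ?exprn_ge0// ler_wpM2l.
rewrite mulr_sumr; apply: ler_sum => k _.
have sB0 : 0 <= s ^+ j0 * s * B k by rewrite !mulr_ge0// exprn_ge0.
have [->|kj0] := eqVneq k j0; first by rewrite subrr normc0 !mulr_ge0// exprn_ge0.
rewrite subr0; move: kj0; rewrite neq_ltn => /orP[/b0 ->|j0k].
  by rewrite mul0r normc0.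
rewrite bs mulrC ler_pM ?normc_ge0 ?exprn_ge0// -exprSr.
exact: ler_wiXn2l.
Qed.

Lemma has_radius_of_cvg rho c (f : (R[i])^o -> (R[i])^o) :
  (forall z, disk rho z ->
    series (fun k => c k * z ^+ k : (R[i])^o) @ \oo --> f z) ->
  has_radius rho c.
Proof.
move=> fc s s0 srho.
have : disk rho s%:C by rewrite /disk/= normr_normc normc_real// ltcR.
move=> /fc cs.
have /cvg_series_cvg_0 /normc_comp_continuous : cvgn (series
  (fun k => c k * s%:C ^+ k : (R[i])^o)) by apply/cvg_ex; exists (f s%:C).
move=> cs0; have /cvg_seq_bounded [M [_ hM]] : cvgn (fun k =>
  normc (c k * s%:C ^+ k)) by apply/cvg_ex; exists (normc (0 : R[i])); exact: cs0.
exists (M + 1) => k.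
have := hM (M + 1) (ltr_pwDr ltr01 (lexx _)) k I.
by rewrite /= ger0_norm ?normc_ge0// normcM normc_pow normc_real.
Qed.

End power_series_complements.

(** * The weights of the Lorentz polynomials *)

Section pq_coefficients.
Context {R : realType}.
Variables p q : R.
Hypotheses (p1 : 1 < p) (pq : p < q).
Implicit Types (b : nat -> R[i]) (z : R[i]) (rho : R) (n j k m : nat).

Let p0 : 0 < p := lt_trans ltr01 p1.
Let q0 : 0 < q := lt_trans p0 pq.
Let qp0 : 0 < q - p. Proof. by rewrite subr_gt0. Qed.

Lemma pqintE n : pqint p q n = (q ^+ n - p ^+ n) / (q - p).
Proof. by rewrite /pqint -(opprB q p) -(opprB (q ^+ n)) invrN mulrNN. Qed.

Lemma pqint_ge0 n : 0 <= pqint p q n.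
Proof.
rewrite pqintE divr_ge0 ?(ltW qp0)// subr_ge0.
by rewrite lerXn2r ?nnegrE ?ltW// (lt_trans p0).
Qed.

Lemma pqint_gt0 n : (0 < n)%N -> 0 < pqint p q n.
Proof.
move=> n0; rewrite pqintE divr_gt0// subr_gt0.
by rewrite ltrXn2r ?nnegrE ?ltW// -lt0n.
Qed.

Lemma pqint0 : pqint p q 0 = 0.
Proof. by rewrite pqintE !expr0 subrr mul0r. Qed.

Lemma pqint1 : pqint p q 1 = 1.
Proof. by rewrite pqintE !expr1 divff// gt_eqF. Qed.

(** This identity turns each factor [q ^ j [n - j] / [n]] of the weights into
    1 minus a multiple of the rate. *)
Lemma pqint_split n j : (j <= n)%N ->
  q ^+ j * pqint p q (n - j) + p ^+ (n - j) * pqint p q j = pqint p q n.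
Proof.
move=> /subnK {3}<-; rewrite !pqintE !exprD.
by field; rewrite gt_eqF.
Qed.

Lemma pqfact0 : pqfact p q 0 = 1.
Proof. by rewrite /pqfact big_geq. Qed.

Lemma pqfactS n : pqfact p q n.+1 = pqfact p q n * pqint p q n.+1.
Proof. by rewrite /pqfact big_nat_recr. Qed.

Lemma pqfact_gt0 n : 0 < pqfact p q n.
Proof.
by elim: n => [|n IH]; rewrite ?pqfact0// pqfactS mulr_gt0 ?pqint_gt0.
Qed.

Definition coef_pqderiv b : nat -> R[i] := fun k => (pqint p q k.+1)%:C * b k.+1.

Lemma has_radius_coef_pqderiv rho b :
  has_radius rho b -> has_radius (rho / q) (coef_pqderiv b).
Proof.
move=> /has_radius_shift; apply: (has_radius_weight _ _ _ (q / (q - p)) _ q0).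
move=> k; rewrite normc_real ?pqint_ge0// pqintE mulrAC -exprS.
by rewrite ler_pM2r ?invr_gt0// gerBl exprn_ge0// ltW.
Qed.

(** The operator [pqderive] divides the radius of validity by [q]: it samples
    the function at [q * z], and off the disk the function is arbitrary. *)
Lemma pqderive_power_sum rho b f : has_radius rho b ->
  (forall z, normc z < rho -> f z = power_sum b z) ->
  forall z, normc z < rho / q ->
  pqderive p q f z = power_sum (coef_pqderiv b) z.
Proof.
move=> hb fb z zrho; rewrite /pqderive.
have rho0 : 0 < rho.
  by have := le_lt_trans (normc_ge0 _) zrho; rewrite pmulr_lgt0 ?invr_gt0.
case: eqP => [->|/eqP z0].
  rewrite (derive1_power_sum _ _ _ hb fb) ?normc0// !power_sum0.
  by rewrite /coef_deriv /coef_pqderiv pqint1.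
have hpow x : 0 <= x -> x <= q ->
    has_radius (rho / q) (fun k => x%:C ^+ k * b k).
  move=> x0 xq; apply: (has_radius_weight _ _ _ 1 _ q0) hb => k.
  by rewrite normc_pow normc_real// mul1r lerXn2r ?nnegrE// ltW.
have fx x : 0 <= x -> x <= q ->
    f (x%:C * z) = power_sum (fun k => x%:C ^+ k * b k) z.
  move=> x0 xq; rewrite -power_sum_scale fb// normcM normc_real//.
  apply: (@le_lt_trans _ _ (q * normc z)); first by rewrite ler_wpM2r ?normc_ge0.
  by move: zrho; rewrite ltr_pdivlMr// mulrC.
have pq0 : (p - q)%:C != 0 :> R[i].
  by rewrite eq_complex /= eqxx andbT subr_eq0 lt_eqF.
have := power_sum_lincomb _ _ _ _ 1 (hpow p (ltW p0) (ltW pq))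
  (hpow q (ltW q0) (lexx q)) zrho.
rewrite mul1r (fx p (ltW p0) (ltW pq)) (fx q (ltW q0) (lexx q)) => ->.
rewrite (power_sum_factor _ _ (coef_pqderiv b) (p - q)%:C _
  (has_radius_coef_pqderiv _ _ hb) zrho).
- by rewrite mulrAC divff ?mul1r// mulf_neq0.
- by rewrite !expr0 !mul1r subrr.
move=> k; rewrite /coef_pqderiv mul1r -mulrBl -!rmorphXn -rmorphB mulrA -rmorphM.
congr (_%:C * _).
by rewrite /pqint mulrC divfK// subr_eq0 lt_eqF.
Qed.

Lemma iter_coef_pqderivE k b j :
  iter k coef_pqderiv b j * (pqfact p q j)%:C =
  (pqfact p q (j + k))%:C * b (j + k)%N.
Proof.
elim: k j => [|k IH] j; first by rewrite addn0 mulrC.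
rewrite addnS -addSn -IH pqfactS iterS {1}/coef_pqderiv.
rewrite [(pqfact p q j * _)%:C]rmorphM mulrAC [LHS]mulrC.
by congr (_ * _); exact: mulrC.
Qed.

(** Each application of [pqderive] divides the radius by [q], but a finite
    number of them leaves a neighbourhood of 0. *)
Lemma pqderiven_power_sum0 rho b f k : 0 < rho -> has_radius rho b ->
  (forall z, normc z < rho -> f z = power_sum b z) ->
  pqderiven p q k f 0 = (pqfact p q k)%:C * b k.
Proof.
move=> rho0 hb fb.
have [hk fk] : has_radius (rho / q ^+ k) (iter k coef_pqderiv b) /\
    forall z, normc z < rho / q ^+ k ->
    pqderiven p q k f z = power_sum (iter k coef_pqderiv b) z.
  elim: k => [|k [hk fk]]; first by rewrite expr0 divr1.
  rewrite exprSr invfM mulrA; split; first exact: has_radius_coef_pqderiv.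
  exact: pqderive_power_sum.
rewrite fk ?normc0 ?divr_gt0 ?exprn_gt0// power_sum0.
by have := iter_coef_pqderivE k b 0; rewrite pqfact0 mulr1 add0n.
Qed.

Definition lorentz_rate n : R := p ^+ n / pqint p q n.

Definition scaled_pqint j : R := pqint p q j / p ^+ j.

(** The product may run past [n] and is then 0, so that a single formula covers
    all Taylor coefficients. *)
Definition lorentz_weight n k : R :=
  \prod_(0 <= j < k) (1 - lorentz_rate n * scaled_pqint j).

Lemma lorentz_weightS n k :
  lorentz_weight n k.+1 = lorentz_weight n k * (1 - lorentz_rate n * scaled_pqint k).
Proof. by rewrite /lorentz_weight big_nat_recr. Qed.

(** The form with a quotient shows the sign of the factor, and that it is 0 at
    [j = n]. *)
Lemma lorentz_factorE n j : (0 < n)%N -> (j <= n)%N ->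
  1 - lorentz_rate n * scaled_pqint j = q ^+ j * pqint p q (n - j) / pqint p q n.
Proof.
move=> n0 jn; have := pqint_split _ _ jn; have := pqint_gt0 _ n0.
rewrite /lorentz_rate /scaled_pqint => N0 E.
have -> : p ^+ n = p ^+ (n - j) * p ^+ j by rewrite -exprD subnK.
have -> : q ^+ j * pqint p q (n - j) =
  pqint p q n - p ^+ (n - j) * pqint p q j by rewrite -E addrK.
by field; rewrite !gt_eqF ?exprn_gt0.
Qed.

(** The product of the factors is the coefficient of the definition of the
    Lorentz polynomials times the [[k]!] coming from the iterated
    [(p, q)]-derivative. *)
Lemma lorentz_weightE n k : (0 < n)%N -> (k <= n)%N ->
  lorentz_weight n k = q ^+ (k * (k - 1) %/ 2) * pqbin p q n k *
    pqfact p q k / pqint p q n ^+ k.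
Proof.
move=> n0; have N0 := pqint_gt0 _ n0.
suff E : (k <= n)%N -> lorentz_weight n k =
    q ^+ 'C(k, 2) * pqfact p q n / pqfact p q (n - k) / pqint p q n ^+ k.
  move=> kn; rewrite (E kn) subn1 divn2 -bin2 /pqbin.
  by field; rewrite expf_neq0 ?gt_eqF ?pqfact_gt0.
elim: k => [_|k IH kn].
  rewrite /lorentz_weight big_geq// subn0 bin0n !expr0 mul1r.
  by rewrite divff ?gt_eqF ?pqfact_gt0// divr1.
rewrite lorentz_weightS (IH (ltnW kn)) lorentz_factorE ?(ltnW kn)//.
rewrite binS bin1 exprD exprS subnS -(@prednK (n - k)) ?subn_gt0// pqfactS.
have := pqint_gt0 (n - k).-1.+1 isT; have := pqfact_gt0 (n - k).-1 => F0 I0.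
by rewrite -pred_Sn; field; rewrite expf_neq0 ?gt_eqF.
Qed.

Lemma lorentz_rate_gt0 n : (0 < n)%N -> 0 < lorentz_rate n.
Proof. by move=> n0; rewrite divr_gt0 ?exprn_gt0// pqint_gt0. Qed.

Lemma scaled_pqint_ge0 j : 0 <= scaled_pqint j.
Proof. by rewrite divr_ge0 ?pqint_ge0// exprn_ge0// ltW. Qed.

Lemma lorentz_factor_ge0 n j : (0 < n)%N -> (j <= n)%N ->
  0 <= 1 - lorentz_rate n * scaled_pqint j.
Proof.
move=> n0 jn; rewrite lorentz_factorE// divr_ge0 ?pqint_ge0// mulr_ge0//.
  by rewrite exprn_ge0// ltW.
exact: pqint_ge0.
Qed.

(** The factor of index [n] is 0, so the infinite series with these weights is
    the Lorentz polynomial of degree at most [n]. *)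
Lemma lorentz_weight_gt n k : (0 < n)%N -> (n < k)%N -> lorentz_weight n k = 0.
Proof.
move=> n0 nk; rewrite /lorentz_weight (bigD1_seq n) ?iota_uniq//=; last first.
  by rewrite mem_index_iota.
by rewrite lorentz_factorE// subnn pqint0 mulr0 mul0r mul0r.
Qed.

Lemma lorentz_weight_ge0 n k : (0 < n)%N -> 0 <= lorentz_weight n k.
Proof.
move=> n0; have [nk|kn] := ltnP n k; first by rewrite lorentz_weight_gt.
elim: k kn => [_|k IH kn]; first by rewrite /lorentz_weight big_geq.
by rewrite lorentz_weightS mulr_ge0 ?IH ?lorentz_factor_ge0// ltnW.
Qed.

Lemma lorentz_weightS_le n k : (0 < n)%N ->
  lorentz_weight n k.+1 <= lorentz_weight n k.
Proof.
move=> n0; rewrite lorentz_weightS ler_piMr ?lorentz_weight_ge0//.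
by rewrite gerBl mulr_ge0 ?scaled_pqint_ge0// ltW// lorentz_rate_gt0.
Qed.

Lemma lorentz_weight_le1 n k : (0 < n)%N -> lorentz_weight n k <= 1.
Proof.
move=> n0; elim: k => [|k IH]; first by rewrite /lorentz_weight big_geq.
exact: le_trans (lorentz_weightS_le _ _ n0) IH.
Qed.

Definition scaled_pqint_sum k : R := \sum_(0 <= j < k) scaled_pqint j.

(** Union bound [1 - prod (1 - u_j) <= sum u_j]. It survives past [j = n], where
    factors may be negative: the product is then 0 and the sum only grows. *)
Lemma lorentz_defect_le n k : (0 < n)%N ->
  1 - lorentz_weight n k <= lorentz_rate n * scaled_pqint_sum k.
Proof.
move=> n0; elim: k => [|k IH].
  by rewrite /lorentz_weight /scaled_pqint_sum !big_geq// subrr mulr0.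
rewrite lorentz_weightS /scaled_pqint_sum big_nat_recr//= -/(scaled_pqint_sum k) mulrDr.
have a0 : 0 <= lorentz_rate n * scaled_pqint k.
  by rewrite mulr_ge0 ?scaled_pqint_ge0// ltW// lorentz_rate_gt0.
have := ler_piMl a0 (lorentz_weight_le1 n k n0).
lra.
Qed.

(** The weights decrease in [k], and the one of index 2 is
    [1 - lorentz_rate n / p]: its factor of index 0 is 1. *)
Lemma lorentz_defect_ge n k : (0 < n)%N -> (1 < k)%N ->
  lorentz_rate n * p^-1 <= 1 - lorentz_weight n k.
Proof.
move=> n0; elim: k => // k IH; rewrite ltnS leq_eqVlt => /orP[/eqP <-|k1].
  rewrite /lorentz_weight big_nat_recr//= big_nat1 /scaled_pqint pqint0 pqint1.
  by rewrite mul0r mulr0 subr0 mul1r opprB addrC subrK expr1 mul1r.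
by apply: le_trans (IH k1) _; rewrite lerB// lorentz_weightS_le.
Qed.

Lemma lorentz_weight_small n k : (k <= 1)%N -> lorentz_weight n k = 1.
Proof.
case: k => [|[|//]] _; rewrite /lorentz_weight; first by rewrite big_geq.
rewrite big_nat1.
by rewrite /scaled_pqint pqint0 mul0r mulr0 subr0.
Qed.

Lemma scaled_pqint_sum_ge0 k : 0 <= scaled_pqint_sum k.
Proof. by apply: sumr_ge0 => j _; exact: scaled_pqint_ge0. Qed.

Lemma scaled_pqint_sum_le : exists A, forall k, scaled_pqint_sum k <= A * (q / p) ^+ k.
Proof.
have t1 : 0 < q / p - 1 by rewrite subr_gt0 ltr_pdivlMr// mul1r.
(* Geometric sum of the bound [w_j <= (q / p) ^ j / (q - p)]. *)
exists ((q - p)^-1 / (q / p - 1)); elim=> [|k IH].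
  rewrite /scaled_pqint_sum big_geq// expr0 mulr1 divr_ge0 ?(ltW t1)//.
  by rewrite invr_ge0 (ltW qp0).
rewrite /scaled_pqint_sum big_nat_recr//=.
apply: (le_trans (lerD IH (_ : _ <= (q - p)^-1 * (q / p) ^+ k))).
  rewrite /scaled_pqint pqintE mulrAC [leLHS]mulrC ler_pM2l ?invr_gt0//.
  rewrite expr_div_n ler_pM2r ?invr_gt0 ?exprn_gt0//.
  by rewrite gerBl exprn_ge0// ltW.
rewrite exprS; set T := (q / p) ^+ k; set t := q / p in t1 *.
by rewrite le_eqVlt; apply/orP; left; apply/eqP; field; rewrite !gt_eqF.
Qed.

Lemma pqlorentz_power_sum rho b f n : (0 < n)%N -> 0 < rho ->
  has_radius rho b -> (forall z, normc z < rho -> f z = power_sum b z) ->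
  forall z, pqlorentz p q n f z =
            power_sum (fun k => (lorentz_weight n k)%:C * b k) z.
Proof.
move=> n0 rho0 hb fb z; rewrite (@power_sum_finite _ _ _ n.+1); last first.
  by move=> k nk; rewrite lorentz_weight_gt// mul0r.
apply: eq_big_nat => k /andP[_ kn].
rewrite (pqderiven_power_sum0 _ _ _ _ rho0 hb fb) lorentz_weightE//.
rewrite [in RHS]rmorphM [in RHS]rmorphM fmorphV rmorphXn expr_div_n.
ring.
Qed.

End pq_coefficients.

(** * The two-sided estimate of the error *)

Lemma eq_maxnorm (R : realType) (r : R) (g h : (R[i])^o -> (R[i])^o) :
  (forall z, normc z <= r -> g z = h z) -> maxnorm r g = maxnorm r h.
Proof.
move=> gh; rewrite /maxnorm; congr (xget 0 (_ `&` ubound _)).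
all: apply/seteqP; split=> x /= [z zr zx]; exists z => //.
all: by move: zx; rewrite gh//; move: zr; rewrite normr_normc lecR.
Qed.

Lemma exists_coef_neq0 (R : realType) (rad : R) (d : nat) (c : nat -> R[i])
    (f : (R[i])^o -> (R[i])^o) :
  (forall z, normc z < rad -> f z = power_sum c z) ->
  ~ poly_on_disk rad d f -> exists k, (d < k)%N && (c k != 0).
Proof.
move=> fc; apply: contra_notP => nk.
have c0 k : (d.+1 <= k)%N -> c k = 0.
  by move=> dk; apply/eqP/negP => /negP ck; apply: nk; exists k; rewrite dk.
exists (\poly_(k < d.+1) c k); split; first exact: size_poly.
move=> z; rewrite /disk/= normr_normc ltcR => zrad.
by rewrite fc// (power_sum_finite _ _ _ c0) horner_poly big_mkord.
Qed.

Section two_sided_bound.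
Context {R : realType}.
Variables (p q rad r : R) (m : nat) (c : nat -> R[i]).
Hypotheses (p1 : 1 < p) (pq : p < q) (r1 : 1 <= r) (r_rad : r < rad / (q / p)).
Hypothesis c_rad : has_radius rad c.

Let t1 : 1 < q / p.
Proof. by rewrite ltr_pdivlMr ?mul1r// (lt_trans ltr01). Qed.

Let t0 : 0 < q / p := lt_trans ltr01 t1.

Let r0 : 0 <= r := le_trans ler01 r1.

Lemma radius_lt : r < rad.
Proof.
have : r * (q / p) < rad by move: r_rad; rewrite ltr_pdivlMr.
by apply: le_lt_trans; rewrite ler_peMr// ltW.
Qed.

(** Coefficients of the m-th derivative of [L_n f - f]. *)
Definition error_coef n : nat -> R[i] :=
  iter m coef_deriv (fun k => (lorentz_weight p q n k - 1)%:C * c k).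

(** Coefficients that dominate those of [error_coef n], divided by the rate,
    uniformly in [n]. *)
Definition majorant_coef : nat -> R[i] :=
  iter m coef_deriv (fun k => (scaled_pqint_sum p q k)%:C * c k).

Lemma majorant_coef_radius : has_radius (rad / (q / p)) majorant_coef.
Proof.
have [A hA] := scaled_pqint_sum_le _ _ p1 pq.
apply: has_radius_iter_coef_deriv; apply: has_radius_weight t0 _ c_rad.
by move=> k; rewrite normc_real ?scaled_pqint_sum_ge0//; exact: hA.
Qed.

Lemma error_coef_radius n : (0 < n)%N -> has_radius rad (error_coef n).
Proof.
move=> n0; rewrite -[rad]divr1; apply: has_radius_iter_coef_deriv.
apply: (has_radius_weight _ _ _ 1 _ ltr01) c_rad => k.
rewrite expr1n mulr1 -normc_opp -rmorphN opprB normc_real.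
  by rewrite gerBl lorentz_weight_ge0.
by rewrite subr_ge0 lorentz_weight_le1.
Qed.

Lemma normc_error_coef n k : (0 < n)%N -> normc (error_coef n k) =
  (1 - lorentz_weight p q n (k + m)) * normc (iter m coef_deriv c k).
Proof.
move=> n0; rewrite /error_coef (iter_coef_deriv_weight _ (fun k => _%:C)).
rewrite normcM -normc_opp -rmorphN opprB normc_real//.
by rewrite subr_ge0 lorentz_weight_le1.
Qed.

Lemma normc_error_coef_le n k : (0 < n)%N ->
  normc (error_coef n k) <= lorentz_rate p q n * normc (majorant_coef k).
Proof.
move=> n0; rewrite normc_error_coef//.
rewrite /majorant_coef (iter_coef_deriv_weight _ (fun k => _%:C)).
rewrite normcM normc_real ?scaled_pqint_sum_ge0// mulrA ler_wpM2r ?normc_ge0//.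
exact: lorentz_defect_le.
Qed.

Lemma derive1n_error f n z : (0 < n)%N ->
  (forall z, normc z < rad -> f z = power_sum c z) -> normc z < rad ->
  derive1n m (pqlorentz p q n f) z - derive1n m f z =
  power_sum (error_coef n) z.
Proof.
move=> n0 fc zrad.
have rad0 : 0 < rad := le_lt_trans (normc_ge0 z) zrad.
have wc_rad : has_radius rad (fun k => (lorentz_weight p q n k)%:C * c k).
  rewrite -[rad]divr1; apply: (has_radius_weight _ _ _ 1 _ ltr01) c_rad => k.
  rewrite expr1n mulr1 normc_real ?lorentz_weight_ge0//.
  exact: lorentz_weight_le1.
rewrite (derive1n_power_sum _ _ _ _ wc_rad) => [|w _|//]; last first.
  exact: pqlorentz_power_sum fc w.
rewrite (derive1n_power_sum _ _ _ _ c_rad fc)//.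
have := power_sum_lincomb _ _ _ _ 1
  (has_radius_iter_coef_deriv _ _ m wc_rad)
  (has_radius_iter_coef_deriv _ _ m c_rad) zrad.
rewrite mul1r => ->; apply: eq_power_sum => k.
rewrite /error_coef !(iter_coef_deriv_weight _ (fun k => _%:C)).
by rewrite -mulrBl rmorphB.
Qed.

Lemma error_upper : exists C2, forall n z, (0 < n)%N -> normc z <= r ->
  normc (power_sum (error_coef n) z) <= C2 * lorentz_rate p q n.
Proof.
have [V hV] := has_radius_summable _ _ _ majorant_coef_radius r0 r_rad.
exists V => n z n0 zr; apply: normc_power_sum_le zr _ => N.
have x0 := ltW (lorentz_rate_gt0 _ _ p1 pq _ n0).
rewrite mulrC; apply: le_trans (ler_wpM2l x0 (hV N)).
rewrite mulr_sumr; apply: ler_sum => k _; rewrite mulrA ler_wpM2r//.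
  exact: exprn_ge0.
exact: normc_error_coef_le.
Qed.

(** Evaluation at a fixed small real point suffices: the least relevant
    coefficient is of exact order [lorentz_rate n], and all the coefficients are
    at most of that order. *)
Lemma error_lower k : (1 < k)%N -> (m <= k)%N -> c k != 0 ->
  (forall j, (1 < j)%N -> (m <= j)%N -> (j < k)%N -> c j = 0) ->
  exists C1 s, [/\ 0 < C1, 0 <= s, s <= r & forall n, (0 < n)%N ->
    C1 * lorentz_rate p q n <= normc (power_sum (error_coef n) s%:C)].
Proof.
move=> k1 mk ck cj.
have [|V hV] := has_radius_summable _ _ _ majorant_coef_radius ler01.
  exact: le_lt_trans r_rad.
have V0 : 0 <= V by have := hV 0%N; rewrite big_geq.
set j0 := (k - m)%N; have j0m : (j0 + m)%N = k by rewrite subnK.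
set beta := p^-1 * normc (iter m coef_deriv c j0).
have beta0 : 0 < beta.
  rewrite mulr_gt0 ?invr_gt0 ?(lt_trans ltr01 p1)// normc_gt0 iter_coef_derivE.
  by rewrite j0m mulf_neq0// pnatr_eq0 -lt0n ffact_gt0.
(* With this [s], the tail costs at most half of the leading term. *)
set s := beta / (2 * (V + beta)).
have Vb : 0 < V + beta by rewrite ltr_wpDl.
have s0 : 0 < s by rewrite divr_gt0// mulr_gt0.
have s1 : s <= 1 by rewrite ler_pdivrMr ?mulr_gt0// mul1r; lra.
have sV : s * V <= beta / 2.
  rewrite /s -mulrA [_^-1 * _]mulrC mulrA ler_pdivrMr ?mulr_gt0//.
  by have := mulr_ge0 (ltW beta0) (ltW beta0); nra.
exists (s ^+ j0 * (beta / 2)), s; split.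
- by rewrite mulr_gt0 ?exprn_gt0// divr_gt0.
- exact: ltW.
- exact: le_trans r1.
move=> n n0; have x0 := lorentz_rate_gt0 _ _ p1 pq _ n0.
have := @normc_power_sum_ge _ (error_coef n)
  (fun k => lorentz_rate p q n * normc (majorant_coef k)) j0 s
  (lorentz_rate p q n * V) (ltW s0) s1.
move=> /(_ _ _ _)/(le_trans _); apply; first last.
- move=> N; rewrite -mulr_sumr ler_wpM2l ?(ltW x0)//; apply: le_trans (hV N).
  by apply: ler_sum => i _; rewrite expr1n mulr1.
- by move=> i; exact: normc_error_coef_le.
- move=> j jj0; apply: eq0_normc; rewrite normc_error_coef//.
  have [j1|j1] := ltnP 1 (j + m); last first.
    by rewrite lorentz_weight_small// subrr mul0r.
  rewrite iter_coef_derivE cj ?leq_addl//; last by rewrite -j0m ltn_add2r.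
  by rewrite mulr0 normc0 mulr0.
rewrite -mulrA ler_wpM2l ?exprn_ge0 ?(ltW s0)// normc_error_coef// j0m.
have := ler_wpM2r (normc_ge0 (iter m coef_deriv c j0))
  (lorentz_defect_ge _ _ p1 pq _ _ n0 k1).
rewrite -mulrA -/beta; have := ler_wpM2l (ltW x0) sV; lra.
Qed.

End two_sided_bound.

Theorem theorem3p1 (R : realType) (p q rad r rstar r1 : R) (m : nat)
    (f : (R[i])^o -> (R[i])^o)
    (hp : 1 < p) (hpq : p < q)
    (hq : 1 < q ^+ 4 / p ^+ 4) (hrad : q ^+ 4 / p ^+ 4 < rad)
    (hf : analytic_on_disk rad f)
    (hr : 1 <= r) (hrstar : r < rstar) (hr1 : rstar < p ^+ 3 * r1 / q ^+ 3)
    (hr1rad : p ^+ 3 * r1 / q ^+ 3 < p ^+ 4 * rad / q ^+ 4)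
    (hm : (1 <= m)%N)
    (hpoly : ~ poly_on_disk rad (maxn 1 (m - 1)) f) :
  exists C1 C2 : R, [/\ 0 < C1, C1 <= C2 &
    forall n : nat, (1 <= n)%N ->
      let N := maxnorm r (fun z => derive1n m (pqlorentz p q n f) z
                                   - derive1n m f z) in
      C1 * (p ^+ n / pqint p q n) <= N /\
      N <= C2 * (p ^+ n / pqint p q n)].
Proof.
have p0 : 0 < p := lt_trans ltr01 hp.
have q0 : 0 < q := lt_trans p0 hpq.
have [c fc'] := hf.
have c_rad := has_radius_of_cvg _ _ _ fc'.
have fc z : normc z < rad -> f z = power_sum c z.
  move=> zrad; apply/esym/cvgC_unique/fc'.
  by rewrite /disk/= normr_normc ltcR.
have t1 : 1 < q / p by rewrite ltr_pdivlMr// mul1r.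
have r_rad : r < rad / (q / p).
  have rt : r < rad / (q / p) ^+ 4.
    rewrite expr_div_n invf_div mulrCA mulrA.
    exact: lt_trans hrstar (lt_trans hr1 hr1rad).
  have rad0 : 0 < rad by apply: lt_trans hrad; exact: lt_trans ltr01 hq.
  apply: lt_le_trans rt _; rewrite ler_wpM2l ?(ltW rad0)//.
  rewrite lef_pV2 ?posrE ?exprn_gt0 ?divr_gt0//.
  by rewrite -[leLHS]expr1 ler_weXn2l// ltW.
have rrad := radius_lt _ _ _ _ hp hpq hr r_rad.
have [k0 /andP[dk0 ck0] k0min] := ex_minnP (exists_coef_neq0 _ _ _ _ _ fc hpoly).
move: dk0; rewrite gtn_max => /andP[k1 mk].
have mk0 : (m <= k0)%N by move: mk; rewrite subn1 prednK.
have [|C1 [s [C10 s0 sr lower]]] := error_lower _ _ _ _ m _ hp hpq hr r_rad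
  c_rad _ k1 mk0 ck0.
  move=> j j1 mj jk; apply/eqP/negP => /negP cj.
  have mj' : (m - 1 < j)%N by rewrite subn1 prednK.
  by have := k0min j; rewrite gtn_max cj j1 mj' leqNgt jk => /(_ isT).
have [C2 upper] := error_upper _ _ _ _ m _ hp hpq hr r_rad c_rad.
have bounds n : (1 <= n)%N ->
    let N := maxnorm r (fun z => derive1n m (pqlorentz p q n f) z
                                 - derive1n m f z) in
    C1 * (p ^+ n / pqint p q n) <= N /\ N <= C2 * (p ^+ n / pqint p q n).
  move=> n0 /=.
  rewrite (@eq_maxnorm _ _ _ (power_sum (error_coef p q m c n))); last first.
    move=> z zr; have zrad := le_lt_trans zr rrad.
    exact: (derive1n_error _ _ _ _ _ hp hpq c_rad _ _ _ n0 fc zrad).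
  have [|[z zr ->] ub] := maxnorm_attained r (power_sum (error_coef p q m c n))
    (le_trans ler01 hr).
    move=> z zr; apply: power_sum_continuous (le_lt_trans zr rrad).
    exact: error_coef_radius.
  split; last exact: upper.
  apply: le_trans (lower n n0) (ub _ _).
  by rewrite normc_real.
exists C1, C2; split=> //; have [lo up] := bounds 1%N isT.
have := le_trans lo up; rewrite ler_pM2r//.
exact: lorentz_rate_gt0.
Qed.
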